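(* For any integer $q\ge2$, $\varepsilon>0$ and sufficiently large $n$, let $C^q_{n,\varepsilon}=\{A^q_{r,n}: r=(1/\varepsilon^4)^k,\ k\text{ a nonnegative integer},\ k<\log_{1/\varepsilon^4}n\}$. For any $(\gamma,\delta)\in(1-\varepsilon)F_q$, $C^q_{n,\varepsilon}$ is list decodable from any $\delta n$ deletions and $\gamma n$ insertions with list size $O(q^5/\varepsilon^2)$; equivalently, for every $z\in\{1,\dots,q-1\}$ and all $\gamma,\delta\ge 0$ with $\gamma+2z\delta\le(1-\varepsilon)\frac{(2q-1)z-z^2}{q}$, every string $v$ can be obtained from at most $O(q^5/\varepsilon^2)$ codewords of $C^q_{n,\varepsilon}$ by at most $\delta n$ deletions and at most $\gamma n$ insertions.
   Context: For a positive integer $r$, $A^q_r=(1^r2^r\cdots q^r)^\infty$ is the infinite string over $\{1,\dots,q\}$ cycling through runs of length $r$ of each symbol, and $A^q_{r,l}$ is its prefix of length $l$. $F_q=\{(\gamma,\delta):\gamma,\delta\ge0,\ \exists z\in\{1,\dots,q-1\}:\ \gamma+2z\delta<\frac{(2q-1)z-z^2}{q}\}$ (the polygon with vertices $(0,0)$ and $(\frac{i(i-1)}q,\frac{q-i}q)$, $i=1,\dots,q$, without its boundary except the segments $[(0,0),(q-1,0))$ and $[(0,0),(0,1-\frac1q))$), and $(1-\varepsilon)F_q$ is its scaling by $1-\varepsilon$. A string $y$ is obtained from $x$ by $D$ deletions and $I$ insertions if it results from deleting $D$ symbols of $x$ and inserting $I$ symbols.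
   Formalization: The base 1/ε⁴ is replaced by ⌈1/ε⁴⌉, because A^q_{r,n} is defined only for integer r and (1/ε⁴)^k need not be an integer; when 1/ε⁴ is an integer the code is exactly the stated one. *)

(* Defs.v *)
From Stdlib Require Import Reals Lra Lia Arith List.
Import ListNotations.
Open Scope R_scope.

Definition word := list nat.

Inductive subseqw : word -> word -> Prop :=
| subseqw_nil : subseqw [] []
| subseqw_skip : forall a w x, subseqw w x -> subseqw w (a :: x)
| subseqw_take : forall a w x, subseqw w x -> subseqw (a :: w) (a :: x).

(* y is obtained from x by D deletions and I insertions:
   delete D symbols of x to get w, then insert I symbols into w to get y. *)
Definition del_ins (D I : nat) (x y : word) : Prop :=
  exists w, subseqw w x /\ subseqw w y /\
            length x = (length w + D)%nat /\ length y = (length w + I)%nat.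

(* A^q_{r,l}: prefix of length l of (1^r 2^r ... q^r)^infinity.
   The i-th symbol (0-indexed) is ((i / r) mod q) + 1. *)
Definition A_str (q r l : nat) : word :=
  map (fun i => (Nat.modulo (Nat.div i r) q + 1)%nat) (seq 0 l).

(* C^q_{n,eps} with base b (= 1/eps^4):
   { A^q_{r,n} : r = b^k, k natural, k < log_b n }  i.e. b^k < n. *)
Definition in_code (q b n : nat) (c : word) : Prop :=
  exists k : nat, (b ^ k < n)%nat /\ c = A_str q (b ^ k) n.

(* Main.v *)
(** Suppose [v] is reached from [A_str q r n] through a common subsequence [w]. Insertions
    plus [2 z] times deletions equal [|v| + 2 z n - (2 z + 1) |w|], so it suffices to bound
    [(2 z + 1) |w|] by about [|v| + (z^2 + z) n / q] for a single codeword of a long list.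

    Cut [v] into blocks of length [l = b^j] and let the energy at scale [l] be the sum over
    blocks and letters of [N^2 / l], where [N] is the number of occurrences of the letter in
    the block. It decreases in [l] and lies in [[0, |v|]] up to rounding, so some run length
    [r = b^k] on the list has nearly the same energy at the scales [b^(k - m)] and
    [b^(k + m)]. The letter densities [p_i] of [v] are then almost constant between the two
    scales. A run of [r] letters [i] matched inside a stretch of [X] letters of [v] therefore
    contributes about [min (r, p_i X)], and [(2 z + 1) min (r, p X) <= r mu (p) + X] for
    [mu (p) = max (0, 2 z + 1 - 1 / p)]. Over one period of [A_str q r] the [r mu (p_i)] add
    up to at most [r (z^2 + z)], because [p_1 + ... + p_q <= 1]. *)
Require Import Defs.
From Stdlib Require Import Reals List Lra Lia Arith.
Import ListNotations.
Open Scope R_scope.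

(** * Finite real sums *)

Fixpoint rsum (n : nat) (f : nat -> R) : R :=
  match n with O => 0 | S k => rsum k f + f k end.

Lemma rsum_ext n f g :
  (forall k, (k < n)%nat -> f k = g k) -> rsum n f = rsum n g.
Proof.
  induction n as [|n IH]; intros H; simpl; [reflexivity|].
  rewrite IH by (intros; apply H; lia). rewrite H by lia. reflexivity.
Qed.

Lemma rsum_le n f g :
  (forall k, (k < n)%nat -> f k <= g k) -> rsum n f <= rsum n g.
Proof.
  induction n as [|n IH]; intros H; simpl; [lra|].
  assert (rsum n f <= rsum n g) by (apply IH; intros; apply H; lia).
  assert (f n <= g n) by (apply H; lia). lra.
Qed.

Lemma rsum_const n a : rsum n (fun _ => a) = INR n * a.
Proof.
  induction n as [|n IH]; [simpl; ring|].
  rewrite S_INR. simpl rsum. rewrite IH. ring.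
Qed.

Lemma rsum_nonneg n f : (forall k, (k < n)%nat -> 0 <= f k) -> 0 <= rsum n f.
Proof.
  intros H. apply Rle_trans with (rsum n (fun _ => 0)).
  - rewrite rsum_const. lra.
  - apply rsum_le. exact H.
Qed.

Lemma rsum_plus n f g : rsum n (fun k => f k + g k) = rsum n f + rsum n g.
Proof. induction n as [|n IH]; simpl; [ring|]. rewrite IH. ring. Qed.

Lemma rsum_scal n a f : rsum n (fun k => a * f k) = a * rsum n f.
Proof. induction n as [|n IH]; simpl; [ring|]. rewrite IH. ring. Qed.

Lemma rsum_swap n m (f : nat -> nat -> R) :
  rsum n (fun i => rsum m (f i)) = rsum m (fun j => rsum n (fun i => f i j)).
Proof.
  induction n as [|n IH]; simpl.
  - rewrite rsum_const. ring.
  - rewrite IH, <- rsum_plus. reflexivity.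
Qed.

Lemma rsum_add n m f : rsum (n + m) f = rsum n f + rsum m (fun j => f (n + j)%nat).
Proof.
  induction m as [|m IH].
  - rewrite Nat.add_0_r. simpl. ring.
  - rewrite Nat.add_succ_r. simpl. rewrite IH. ring.
Qed.

Lemma rsum_mul n m f :
  rsum (n * m) f = rsum n (fun i => rsum m (fun j => f (i * m + j)%nat)).
Proof.
  induction n as [|n IH]; [reflexivity|].
  replace (S n * m)%nat with (n * m + m)%nat by lia.
  rewrite rsum_add, IH. reflexivity.
Qed.

Lemma rsum_telescope n (F : nat -> R) :
  rsum n (fun k => F (S k) - F k) = F n - F 0%nat.
Proof. induction n as [|n IH]; simpl; [ring|]. rewrite IH. ring. Qed.

Lemma rsum_term_le n f i :
  (forall k, (k < n)%nat -> 0 <= f k) -> (i < n)%nat -> f i <= rsum n f.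
Proof.
  intros H Hi. induction n as [|n IH]; [lia|]. simpl.
  assert (0 <= rsum n f) by (apply rsum_nonneg; intros; apply H; lia).
  assert (0 <= f n) by (apply H; lia).
  destruct (Nat.eq_dec i n) as [->|]; [lra|].
  assert (f i <= rsum n f) by (apply IH; [intros; apply H|]; lia). lra.
Qed.

Lemma rsum_le_mono n m f :
  (forall k, 0 <= f k) -> (n <= m)%nat -> rsum n f <= rsum m f.
Proof.
  intros H Hnm. replace m with (n + (m - n))%nat by lia. rewrite rsum_add.
  assert (0 <= rsum (m - n) (fun j => f (n + j)%nat))
    by (apply rsum_nonneg; intros; apply H). lra.
Qed.

(** A Markov-type count. Later [f] is the energy drop at each scale and [l] the list of scales where
    it reaches [theta], so a bound on the total drop bounds the number of such scales. *)
Lemma rsum_NoDup_ge n f theta (l : list nat) :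
  (forall k, (k < n)%nat -> 0 <= f k) ->
  NoDup l ->
  (forall k, In k l -> (k < n)%nat /\ theta <= f k) ->
  INR (length l) * theta <= rsum n f.
Proof.
  revert l. induction n as [|n IH]; intros l Hf Hl H.
  - destruct l as [|k l]; [simpl; lra|].
    destruct (H k) as [? _]; [now left|lia].
  - simpl. assert (Hfn : 0 <= f n) by (apply Hf; lia).
    destruct (in_dec Nat.eq_dec n l) as [Hin|Hout].
    + destruct (H n Hin) as [_ Hth].
      destruct (in_split _ _ Hin) as (l1 & l2 & ->).
      destruct (NoDup_remove _ _ _ Hl) as [Hl' Hn].
      assert (HI : INR (length (l1 ++ l2)) * theta <= rsum n f).
      { apply IH; [intros; apply Hf; lia|exact Hl'|]. intros k Hk.
        assert (In k (l1 ++ n :: l2))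
          by (apply in_app_iff in Hk; apply in_app_iff; simpl; tauto).
        destruct (H k) as [? ?]; [assumption|].
        assert (k <> n) by (intros ->; tauto). split; [lia|assumption]. }
      rewrite length_app in HI |- *. simpl length.
      rewrite Nat.add_succ_r, S_INR. lra.
    + assert (INR (length l) * theta <= rsum n f).
      { apply IH; [intros; apply Hf; lia|exact Hl|]. intros k Hk.
        destruct (H k Hk). assert (k <> n) by (intros ->; tauto).
        split; [lia|assumption]. }
      lra.
Qed.

(** * Subsequences and intervals of words *)

Lemma subseqw_app_inv_r w x y :
  subseqw w (x ++ y) ->
  exists w1 w2, w = w1 ++ w2 /\ subseqw w1 x /\ subseqw w2 y.
Proof.
  revert w. induction x as [|a x IH]; simpl; intros w H.
  - exists [], w. repeat split; [constructor|exact H].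
  - inversion H as [|? ? ? H1|? w' ? H1]; subst.
    + destruct (IH _ H1) as (w1 & w2 & -> & H2 & H3).
      exists w1, w2. repeat split; [constructor|]; assumption.
    + destruct (IH _ H1) as (w1 & w2 & -> & H2 & H3).
      exists (a :: w1), w2. repeat split; [constructor|]; assumption.
Qed.

Lemma subseqw_nil_l x : subseqw [] x.
Proof. induction x; constructor; assumption. Qed.

Lemma subseqw_app_inv_l w1 w2 x :
  subseqw (w1 ++ w2) x ->
  exists x1 x2, x = x1 ++ x2 /\ subseqw w1 x1 /\ subseqw w2 x2.
Proof.
  revert w1. induction x as [|a x IH]; intros w1 H.
  - inversion H as [H0| |]. symmetry in H0.
    destruct (app_eq_nil _ _ H0) as [-> ->].
    exists [], []. repeat split; constructor.
  - destruct w1 as [|c w1].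
    + exists [], (a :: x). repeat split; [constructor|exact H].
    + inversion H as [|? ? ? H1|? w' ? H1]; subst.
      * destruct (IH (c :: w1) H1) as (x1 & x2 & -> & H2 & H3).
        exists (a :: x1), x2. repeat split; [constructor|]; assumption.
      * destruct (IH w1 H1) as (x1 & x2 & -> & H2 & H3).
        exists (a :: x1), x2. repeat split; [constructor|]; assumption.
Qed.

Lemma subseqw_app_r w x y : subseqw w x -> subseqw w (x ++ y).
Proof. induction 1; simpl; [apply subseqw_nil_l|constructor..]; assumption. Qed.

Lemma subseqw_length w x : subseqw w x -> (length w <= length x)%nat.
Proof. induction 1; simpl; lia. Qed.

Lemma subseqw_count_occ a w x :
  subseqw w x -> (count_occ Nat.eq_dec w a <= count_occ Nat.eq_dec x a)%nat.
Proof.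
  induction 1 as [|c w x H IH|c w x H IH]; simpl; [lia|destruct (Nat.eq_dec c a); lia..].
Qed.

Lemma subseqw_repeat a r w : subseqw w (repeat a r) -> w = repeat a (length w).
Proof.
  revert w. induction r as [|r IH]; simpl; intros w H; inversion H; subst; simpl; auto.
  f_equal. auto.
Qed.

(** Intervals are kept as pairs of positions in [v], so that letter counts become differences of
    prefix counts. *)
Definition slice (v : word) (a b : nat) : word := firstn (b - a) (skipn a v).

Lemma firstn_slice v a b : (a <= b)%nat -> firstn b v = firstn a v ++ slice v a b.
Proof.
  intros H. unfold slice. rewrite <- (firstn_skipn a (firstn b v)) at 1.
  rewrite firstn_firstn, skipn_firstn_comm, Nat.min_l by lia. reflexivity.
Qed.

Lemma slice_length v a b : (length (slice v a b) <= b - a)%nat.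
Proof. unfold slice. apply firstn_le_length. Qed.

(** Turns a cut of the matched word into a cut position of [v]; it is applied between periods and,
    inside a period, between runs. *)
Lemma subseqw_app_slice w1 w2 v a b :
  (a <= b)%nat -> subseqw (w1 ++ w2) (slice v a b) ->
  exists c, (a <= c <= b)%nat /\ subseqw w1 (slice v a c) /\ subseqw w2 (slice v c b).
Proof.
  intros Hab H. destruct (subseqw_app_inv_l _ _ _ H) as (x1 & x2 & Hx & H1 & H2).
  pose proof (slice_length v a b) as Hl. rewrite Hx, length_app in Hl.
  exists (a + length x1)%nat. split; [lia|].
  assert (E1 : slice v a (a + length x1) = x1).
  { replace (slice v a (a + length x1)) with (firstn (length x1) (slice v a b)).
    - rewrite Hx, firstn_app, Nat.sub_diag, firstn_all. simpl. apply app_nil_r.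
    - unfold slice. rewrite firstn_firstn. f_equal. lia. }
  assert (E2 : slice v (a + length x1) b = x2).
  { replace (slice v (a + length x1) b) with (skipn (length x1) (slice v a b)).
    - rewrite Hx, skipn_app, Nat.sub_diag, skipn_all. reflexivity.
    - unfold slice. rewrite skipn_firstn_comm, skipn_skipn. f_equal; [lia|f_equal; lia]. }
  rewrite E1, E2. auto.
Qed.

(** * Runs and periods of the codewords *)

Lemma map_seq_shift (f : nat -> nat) a n :
  map f (seq a n) = map (fun i => f (a + i)%nat) (seq 0 n).
Proof.
  induction n as [|n IH]; [reflexivity|].
  rewrite !seq_S, !map_app, IH. reflexivity.
Qed.

Lemma A_str_add q r a c :
  A_str q r (a + c) =
  A_str q r a ++ map (fun i => (Nat.modulo (Nat.div (a + i) r) q + 1)%nat) (seq 0 c).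
Proof. unfold A_str. rewrite seq_app, map_app. f_equal. apply map_seq_shift. Qed.

Lemma A_str_run q r t :
  (0 < r)%nat -> (t < q)%nat ->
  A_str q r (r * S t) = A_str q r (r * t) ++ repeat (S t) r.
Proof.
  intros Hr Ht. replace (r * S t)%nat with (r * t + r)%nat by lia.
  rewrite A_str_add. f_equal.
  transitivity (map (fun _ => S t) (seq 0 r));
    [|rewrite map_const, length_seq; reflexivity].
  apply map_ext_in. intros i Hi. apply in_seq in Hi.
  replace ((r * t + i) / r)%nat with t.
  - rewrite Nat.mod_small by lia. lia.
  - symmetry. rewrite Nat.mul_comm, Nat.div_add_l by lia.
    rewrite Nat.div_small by lia. lia.
Qed.

Lemma A_str_period q r P :
  (0 < r)%nat -> (0 < q)%nat ->
  A_str q r (r * q * S P) = A_str q r (r * q * P) ++ A_str q r (r * q).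
Proof.
  intros Hr Hq. replace (r * q * S P)%nat with (r * q * P + r * q)%nat by lia.
  rewrite A_str_add. f_equal. apply map_ext. intros i.
  replace (r * q * P + i)%nat with (q * P * r + i)%nat by lia.
  rewrite Nat.div_add_l by lia.
  replace (q * P + i / r)%nat with (i / r + P * q)%nat by lia.
  rewrite Nat.Div0.mod_add. reflexivity.
Qed.

(** Allows a codeword to be prolonged to a whole number of periods. *)
Lemma subseqw_A_str_le q r n m w :
  (n <= m)%nat -> subseqw w (A_str q r n) -> subseqw w (A_str q r m).
Proof.
  intros H Hw. replace m with (n + (m - n))%nat by lia. rewrite A_str_add.
  now apply subseqw_app_r.
Qed.

Lemma A_str_length q r n : length (A_str q r n) = n.
Proof. unfold A_str. rewrite length_map. apply length_seq. Qed.

(** * Letter counts in prefixes and blocks *)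

(* The letters of [A_str q] are [1..q]; they are indexed here by [i < q], so that
   [cnt v i x] counts the letter [i + 1] among the first [x] letters of [v]. *)
Definition cnt (v : word) (i x : nat) : R :=
  INR (count_occ Nat.eq_dec (firstn x v) (S i)).

Lemma cnt_slice v i a b :
  (a <= b)%nat ->
  cnt v i b - cnt v i a = INR (count_occ Nat.eq_dec (slice v a b) (S i)).
Proof.
  intros H. unfold cnt. rewrite (firstn_slice v a b H), count_occ_app, plus_INR. ring.
Qed.

Lemma count_occ_sum_le q (x : word) :
  rsum q (fun i => INR (count_occ Nat.eq_dec x (S i))) <= INR (length x).
Proof.
  induction x as [|a x IH].
  - simpl. rewrite rsum_const. lra.
  - assert (Ha : rsum q (fun i => if Nat.eq_dec a (S i) then 1 else 0) <= 1).
    (* The constant bound 1 is not inductive in [q]; the sharper bound is 0 as long as the letter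
       [a] exceeds [q]. *)
    { clear. assert (rsum q (fun i => if Nat.eq_dec a (S i) then 1 else 0)
                     <= if le_lt_dec a q then 1 else 0); [|destruct le_lt_dec; lra].
      induction q as [|q IH]; simpl; [destruct le_lt_dec; lra|].
      destruct (Nat.eq_dec a (S q)); destruct (le_lt_dec a q);
        destruct (le_lt_dec a (S q)); try lia; lra. }
    rewrite (rsum_ext q _ (fun i => (if Nat.eq_dec a (S i) then 1 else 0) +
                                    INR (count_occ Nat.eq_dec x (S i)))).
    + rewrite rsum_plus. simpl length. rewrite S_INR. lra.
    + intros k _. simpl count_occ. destruct (Nat.eq_dec a (S k)); [rewrite S_INR|]; ring.
Qed.

Lemma cnt_diff_bounds v i a b :
  (a <= b)%nat -> 0 <= cnt v i b - cnt v i a <= INR b - INR a.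
Proof.
  intros H. rewrite cnt_slice by exact H. split; [apply pos_INR|].
  rewrite <- minus_INR by exact H. apply le_INR.
  etransitivity; [apply count_occ_bound|apply slice_length].
Qed.

Definition block (v : word) (i l u : nat) : R := cnt v i (l * S u) - cnt v i (l * u).

Lemma block_bounds v i l u : 0 <= block v i l u <= INR l.
Proof.
  unfold block. destruct (cnt_diff_bounds v i (l * u) (l * S u)) as [H1 H2]; [lia|].
  split; [exact H1|]. rewrite <- minus_INR in H2 by lia.
  replace (l * S u - l * u)%nat with l in H2 by lia. exact H2.
Qed.

Lemma block_sum_le q v l u : rsum q (fun i => block v i l u) <= INR l.
Proof.
  rewrite (rsum_ext q _
    (fun i => INR (count_occ Nat.eq_dec (slice v (l * u) (l * S u)) (S i))))
    by (intros; apply cnt_slice; lia).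
  eapply Rle_trans; [apply count_occ_sum_le|]. apply le_INR.
  etransitivity; [apply slice_length|lia].
Qed.

Lemma block_mul v i l B W :
  block v i (l * B) W = rsum B (fun j => block v i l (W * B + j)).
Proof.
  pose proof (rsum_telescope B (fun y => cnt v i (l * (W * B + y)))) as T.
  cbv beta in T. unfold block.
  rewrite (rsum_ext B _ (fun j => cnt v i (l * (W * B + S j)) - cnt v i (l * (W * B + j)))).
  - rewrite T. f_equal; f_equal; lia.
  - intros. do 2 f_equal; lia.
Qed.

(** * Energy and its drop between two scales *)

(** The number [U] of blocks is explicit and the blocks may run past the end of [v], where prefix
    counts stay constant. One and the same covering length can thus be cut at every scale. *)
Definition energy (q : nat) (v : word) (l U : nat) : R :=
  rsum U (fun u => rsum q (fun i => block v i l u ^ 2 / INR l)).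

Lemma energy_nonneg q v l U : (0 < l)%nat -> 0 <= energy q v l U.
Proof.
  intros Hl. apply lt_0_INR in Hl. do 2 (apply rsum_nonneg; intros).
  apply Rmult_le_pos; [apply pow2_ge_0|]. left. now apply Rinv_0_lt_compat.
Qed.

(** A count is at most [l], so its square over [l] is at most the count, and the counts in one block
    add up to at most [l]. *)
Lemma energy_le q v l U : (0 < l)%nat -> energy q v l U <= INR (l * U).
Proof.
  intros Hl. apply lt_0_INR in Hl. unfold energy.
  rewrite mult_INR, Rmult_comm, <- rsum_const. apply rsum_le. intros u _.
  eapply Rle_trans; [|apply (block_sum_le q v l u)]. apply rsum_le. intros i _.
  pose proof (block_bounds v i l u). apply Rmult_le_reg_r with (INR l); [lra|].
  unfold Rdiv. rewrite Rmult_assoc, Rinv_l by lra. nra.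
Qed.

Definition dens (v : word) (i l u : nat) : R := block v i l u / INR l.

(** Squared distance of the letter counts in block [u] from those predicted by the densities of the
    enclosing block of length [l * B], which has index [u / B]. *)
Definition deviation (q : nat) (v : word) (l B u : nat) : R :=
  rsum q (fun i => (block v i l u - INR l * dens v i (l * B) (u / B)) ^ 2 / INR l).

Lemma deviation_nonneg q v l B u : (0 < l)%nat -> 0 <= deviation q v l B u.
Proof.
  intros Hl. apply lt_0_INR in Hl. apply rsum_nonneg. intros.
  apply Rmult_le_pos; [apply pow2_ge_0|]. left. now apply Rinv_0_lt_compat.
Qed.

(** The variance identity: the predicted value is the mean of [f], and the cross term of the
    expanded square cancels half of it. *)
Lemma rsum_variance B l f :
  0 < l -> (0 < B)%nat ->
  rsum B (fun j => (f j - l * (rsum B f / (l * INR B))) ^ 2 / l)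
  = rsum B (fun j => f j ^ 2 / l) - rsum B f ^ 2 / (l * INR B).
Proof.
  intros Hl HB. apply lt_0_INR in HB. set (s := rsum B f).
  rewrite (rsum_ext B _ (fun j => f j ^ 2 / l +
     (- (2 * s / (l * INR B)) * f j + s ^ 2 / (l * INR B ^ 2)))).
  - rewrite !rsum_plus, rsum_scal, rsum_const. fold s. field. lra.
  - intros. field. lra.
Qed.

(** By the variance identity in each large block, the energy lost by merging [B] blocks into one is
    exactly the variance inside the merged blocks. *)
Lemma energy_drop q v l B H :
  (0 < l)%nat -> (0 < B)%nat ->
  rsum (H * B) (deviation q v l B) = energy q v l (H * B) - energy q v (l * B) H.
Proof.
  intros Hl HB. unfold energy. rewrite !rsum_mul.
  enough (E : forall W,
    rsum B (fun j => deviation q v l B (W * B + j)) +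
    rsum q (fun i => block v i (l * B) W ^ 2 / INR (l * B)) =
    rsum B (fun j => rsum q (fun i => block v i l (W * B + j) ^ 2 / INR l))).
  { induction H as [|H IH]; cbn [rsum]; [ring|]. rewrite IH, <- (E H). ring. }
  intros W. unfold deviation. rewrite !(rsum_swap B q), <- rsum_plus. apply rsum_ext.
  intros i _. unfold dens. rewrite mult_INR.
  rewrite (rsum_ext B _ (fun j => (block v i l (W * B + j) -
    INR l * (rsum B (fun j => block v i l (W * B + j)) / (INR l * INR B))) ^ 2 / INR l)).
  - rewrite rsum_variance; [|now apply lt_0_INR|exact HB]. rewrite <- block_mul. ring.
  - intros j Hj. rewrite Nat.div_add_l, Nat.div_small by lia.
    rewrite Nat.add_0_r, block_mul. reflexivity.
Qed.

(** * The extremal function [mu] *)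

(* [r * mu c p] is the maximum over [X >= 0] of [c * Rmin r (p * X) - X]; the guard also
   makes it [0] at [p = 0]. *)
Definition mu (c p : R) : R := if Rlt_dec 1 (c * p) then c - / p else 0.

(** As a function of [X], the difference [c * Rmin r (p * X) - X] has slope [c * p - 1] up to
    [X = r / p] and slope [-1] afterwards. It peaks at [r / p] if [c * p > 1] and at 0 otherwise. *)
Lemma mu_spec c p r X :
  0 <= c -> 0 <= p -> 0 <= r -> 0 <= X ->
  c * Rmin r (p * X) <= r * mu c p + X.
Proof.
  intros Hc Hp Hr HX. unfold mu. destruct (Rlt_dec 1 (c * p)) as [H|H].
  - assert (Hp0 : 0 < p) by nra.
    assert (E : p * / p = 1) by (field; lra).
    assert (0 < / p) by now apply Rinv_0_lt_compat.
    set (s := / p) in *. unfold Rmin. destruct (Rle_dec r (p * X)) as [G|G].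
    + assert (r * s <= X) by (replace X with (p * X * s) by nra; nra). nra.
    + assert (X <= r * s) by (replace X with (p * X * s) by nra; nra).
      replace (c * (p * X)) with ((c * p - 1) * X + X) by ring.
      replace (r * (c - s)) with ((c * p - 1) * (r * s))
        by (transitivity (r * (c * (p * s) - s)); [ring|rewrite E; ring]).
      assert ((c * p - 1) * X <= (c * p - 1) * (r * s))
        by (apply Rmult_le_compat_l; lra). lra.
  - pose proof (Rmin_r r (p * X)).
    assert (c * Rmin r (p * X) <= c * (p * X)) by (apply Rmult_le_compat_l; lra).
    assert (c * p * X <= 1 * X) by (apply Rmult_le_compat_r; lra). lra.
Qed.

(* If [m] of the [mu c (p i)] are positive, then [1 / p >= 2 m - m^2 p] bounds their sum by
   [m (c - m)], and [(m - z) (m - z - 1) >= 0] for integers. *)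
Lemma mu_sum_le q z p :
  (forall i, (i < q)%nat -> 0 <= p i) -> rsum q p <= 1 ->
  rsum q (fun i => mu (2 * INR z + 1) (p i)) <= INR z ^ 2 + INR z.
Proof.
  intros Hp H1. set (c := 2 * INR z + 1).
  (* The parameter [s] stays free because the number [m] of positive terms is known only after the
     induction; then [s] is set to [m]. *)
  assert (E : exists m : nat, forall s,
    rsum q (fun i => mu c (p i)) <= INR m * c - 2 * INR m * s + s ^ 2 * rsum q p).
  { clear H1. induction q as [|q IH].
    - exists 0%nat. intros s. simpl. lra.
    - destruct IH as [m IH]; [intros; apply Hp; lia|].
      assert (Hq : 0 <= p q) by (apply Hp; lia).
      simpl. unfold mu at 2. destruct (Rlt_dec 1 (c * p q)) as [H|H].
      + exists (S m). intros s. rewrite S_INR. specialize (IH s).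
        assert (p q <> 0) by (intros E; rewrite E in H; lra).
        assert (G : 0 <= (1 - s * p q) ^ 2 * / p q)
          by (apply Rmult_le_pos; [apply pow2_ge_0|left; apply Rinv_0_lt_compat; lra]).
        replace ((1 - s * p q) ^ 2 * / p q) with (/ p q - 2 * s + s ^ 2 * p q) in G
          by (field; assumption). lra.
      + exists m. intros s. specialize (IH s). nra. }
  destruct E as [m E]. specialize (E (INR m)).
  assert (INR m ^ 2 * rsum q p <= INR m ^ 2) by (pose proof (pos_INR m); nra).
  assert (0 <= (INR m - INR z) * (INR m - INR z - 1)).
  { destruct (le_lt_dec m z) as [G|G].
    - apply le_INR in G. nra.
    - apply le_INR in G. rewrite S_INR in G. nra. }
  unfold c in *. nra.
Qed.

(** * Upper bounds on the length of a matching *)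

(** The price of replacing a block count by its predicted value. The parameter [eta] balances a
    fixed cost per letter against the deviation, whose sum is an energy drop. *)
Definition error (q : nat) (v : word) (l B : nat) (eta : R) (u : nat) : R :=
  INR l * eta / 2 + deviation q v l B u / (2 * eta).

Lemma error_nonneg q v l B eta u :
  (0 < l)%nat -> 0 < eta -> 0 <= error q v l B eta u.
Proof.
  intros Hl He. unfold error. pose proof (deviation_nonneg q v l B u Hl).
  apply lt_0_INR in Hl.
  assert (0 < / (2 * eta)) by (apply Rinv_0_lt_compat; lra).
  unfold Rdiv. nra.
Qed.

(** With [d] the excess over the prediction, [d <= l * eta / 2 + d ^ 2 / (2 * l * eta)] by the
    arithmetic-geometric mean inequality, and [d ^ 2 / l] is a single term of the deviation. *)
Lemma block_le_dens q v l B eta i u :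
  (0 < l)%nat -> 0 < eta -> (i < q)%nat ->
  block v i l u <= INR l * dens v i (l * B) (u / B) + error q v l B eta u.
Proof.
  intros Hl He Hi. apply lt_0_INR in Hl. unfold error.
  set (d := block v i l u - INR l * dens v i (l * B) (u / B)).
  assert (Hd : d ^ 2 / INR l <= deviation q v l B u).
  { apply (rsum_term_le q (fun i =>
      (block v i l u - INR l * dens v i (l * B) (u / B)) ^ 2 / INR l)); [|exact Hi].
    intros. apply Rmult_le_pos; [apply pow2_ge_0|]. left. now apply Rinv_0_lt_compat. }
  assert (d ^ 2 / INR l / (2 * eta) <= deviation q v l B u / (2 * eta)).
  { apply Rmult_le_compat_r; [|exact Hd]. left. apply Rinv_0_lt_compat. lra. }
  assert (G : 0 <= (d - INR l * eta) ^ 2 / (2 * (INR l * eta))).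
  { apply Rmult_le_pos; [apply pow2_ge_0|]. left. apply Rinv_0_lt_compat. nra. }
  replace ((d - INR l * eta) ^ 2 / (2 * (INR l * eta)))
    with (d ^ 2 / INR l / (2 * eta) + INR l * eta / 2 - d) in G by (field; lra).
  unfold d in *. lra.
Qed.

(** The blocks from [a / l] up to [b / l] lie in the large block [W] and share its density. Rounding
    [a] down only adds letters; the letters after the last full block before [b] cost at most [l].
    Errors are written as differences of prefix sums so that they telescope over consecutive
    stretches. *)
Lemma cnt_diff_le q v l B eta i a b W :
  (0 < l)%nat -> (0 < B)%nat -> 0 < eta -> (i < q)%nat -> (a <= b)%nat ->
  (a / l / B)%nat = W -> (b / l / B)%nat = W ->
  cnt v i b - cnt v i a <=
  INR l + dens v i (l * B) W * (INR l * (INR (b / l) - INR (a / l)))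
  + (rsum (b / l) (error q v l B eta) - rsum (a / l) (error q v l B eta)).
Proof.
  intros Hl HB He Hi Hab Ha Hb.
  assert (Hd : (a / l <= b / l)%nat) by (apply Nat.Div0.div_le_mono; exact Hab).
  assert (H1 : cnt v i b - cnt v i (l * (b / l)) <= INR l).
  { destruct (cnt_diff_bounds v i (l * (b / l)) b) as [_ H];
      [apply Nat.Div0.mul_div_le|].
    rewrite <- minus_INR in H by apply Nat.Div0.mul_div_le.
    eapply Rle_trans; [exact H|]. apply le_INR.
    rewrite (Nat.div_mod b l) at 1 by lia.
    pose proof (Nat.mod_upper_bound b l). lia. }
  assert (H2 : 0 <= cnt v i a - cnt v i (l * (a / l)))
    by (apply cnt_diff_bounds, Nat.Div0.mul_div_le).
  set (y1 := (a / l)%nat) in *. set (y2 := (b / l)%nat) in *.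
  enough (forall k, (y1 + k <= y2)%nat ->
    cnt v i (l * (y1 + k)) - cnt v i (l * y1) <=
    dens v i (l * B) W * (INR l * INR k) +
    (rsum (y1 + k) (error q v l B eta) - rsum y1 (error q v l B eta))) as H.
  { specialize (H (y2 - y1)%nat ltac:(lia)). rewrite minus_INR in H by exact Hd.
    replace (y1 + (y2 - y1))%nat with y2 in H by lia. lra. }
  induction k as [|k IH]; intros Hk.
  - rewrite Nat.add_0_r. simpl. lra.
  - specialize (IH ltac:(lia)). rewrite Nat.add_succ_r, S_INR. simpl rsum.
    pose proof (block_le_dens q v l B eta i (y1 + k) Hl He Hi) as Hu.
    replace ((y1 + k) / B)%nat with W in Hu; [unfold block in Hu; lra|].
    assert (y1 / B <= (y1 + k) / B)%nat by (apply Nat.Div0.div_le_mono; lia).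
    assert ((y1 + k) / B <= y2 / B)%nat by (apply Nat.Div0.div_le_mono; lia). lia.
Qed.

(** Induction on the runs of one period matched inside a single large block. The part matched to a
    run is at most [r] long and at most the count of its letter in the stretch, so [mu_spec]
    applies; each run adds one rounding loss [l]. *)
Lemma period_bound q v l B eta r c W t a b w :
  (0 < l)%nat -> (0 < B)%nat -> 0 < eta -> (0 < r)%nat -> 0 <= c ->
  (t <= q)%nat -> (a <= b)%nat ->
  (a / l / B)%nat = W -> (b / l / B)%nat = W ->
  subseqw w (A_str q r (r * t)) -> subseqw w (slice v a b) ->
  c * INR (length w) <=
  INR r * rsum t (fun i => mu c (dens v i (l * B) W))
  + INR l * (INR (b / l) - INR (a / l))
  + c * (rsum (b / l) (error q v l B eta) - rsum (a / l) (error q v l B eta))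
  + c * (INR t * INR l).
Proof.
  intros Hl HB He Hr Hc. revert b w. induction t as [|t IH]; intros b w Ht Hab Ha Hb Hw1 Hw2.
  - apply subseqw_length in Hw1. rewrite A_str_length, Nat.mul_0_r in Hw1.
    replace (length w) with 0%nat by lia. simpl.
    assert (Hd : (a / l <= b / l)%nat) by (apply Nat.Div0.div_le_mono; exact Hab).
    assert (rsum (a / l) (error q v l B eta) <= rsum (b / l) (error q v l B eta))
      by (apply rsum_le_mono; [intros; now apply error_nonneg|exact Hd]).
    apply le_INR in Hd. pose proof (pos_INR l). nra.
  - rewrite A_str_run in Hw1 by lia.
    destruct (subseqw_app_inv_r _ _ _ Hw1) as (w1 & w2 & -> & H1 & H2).
    destruct (subseqw_app_slice _ _ _ _ _ Hab Hw2) as (x & Hx & H3 & H4).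
    assert (HW : (x / l / B)%nat = W).
    { assert (a / l / B <= x / l / B)%nat
        by (do 2 apply Nat.Div0.div_le_mono; lia).
      assert (x / l / B <= b / l / B)%nat
        by (do 2 apply Nat.Div0.div_le_mono; lia). lia. }
    specialize (IH x w1 ltac:(lia) ltac:(lia) Ha HW H1 H3).
    rewrite length_app, plus_INR, S_INR. simpl rsum.
    pose proof (subseqw_length _ _ H2) as Hlen. rewrite repeat_length in Hlen.
    apply le_INR in Hlen.
    assert (Hcnt : INR (length w2) <= cnt v t b - cnt v t x).
    { rewrite cnt_slice by lia. apply le_INR. apply subseqw_count_occ with (a := S t) in H4.
      rewrite (subseqw_repeat _ _ _ H2), count_occ_repeat_eq in H4 by reflexivity. exact H4. }
    pose proof (cnt_diff_le q v l B eta t x b W Hl HB He ltac:(lia) ltac:(lia) HW Hb) as Hc2.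
    assert (Hd : (x / l <= b / l)%nat) by (apply Nat.Div0.div_le_mono; lia).
    assert (Herr : rsum (x / l) (error q v l B eta) <= rsum (b / l) (error q v l B eta))
      by (apply rsum_le_mono; [intros; now apply error_nonneg|exact Hd]).
    apply le_INR in Hd. pose proof (pos_INR l) as Hl0.
    set (X := INR l * (INR (b / l) - INR (x / l))) in *.
    assert (HX : 0 <= X) by (unfold X; nra).
    set (p := dens v t (l * B) W) in *.
    assert (Hp : 0 <= p).
    { unfold p, dens. apply Rmult_le_pos; [apply block_bounds|].
      left. apply Rinv_0_lt_compat, lt_0_INR. lia. }
    pose proof (mu_spec c p (INR r) X Hc Hp (pos_INR r) HX) as Hmu.
    set (e := rsum (b / l) (error q v l B eta) - rsum (x / l) (error q v l B eta)) in *.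
    assert (Hm : INR (length w2) <= Rmin (INR r) (p * X) + (INR l + e)).
    { unfold Rmin. destruct Rle_dec; unfold e in *; lra. }
    assert (c * INR (length w2) <= c * (Rmin (INR r) (p * X) + (INR l + e)))
      by (apply Rmult_le_compat_l; lra).
    unfold X, e in *. lra.
Qed.

(** Induction on periods. A period matched inside one large block obeys [period_bound] and
    [mu_sum_le]. Any other period advances the large-block index, so there are at most [x / l / B]
    of these, and each is charged its full length [r * q]. *)
Lemma matching_bound q v l B eta r z P x w :
  (0 < q)%nat -> (0 < l)%nat -> (0 < B)%nat -> 0 < eta -> (0 < r)%nat ->
  subseqw w (A_str q r (r * q * P)) -> subseqw w (slice v 0 x) ->
  (2 * INR z + 1) * INR (length w) <=
  (2 * INR z + 1) * (INR r * INR q) * INR (x / l / B)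
  + INR r * INR P * (INR z ^ 2 + INR z)
  + INR l * INR (x / l)
  + (2 * INR z + 1) * rsum (x / l) (error q v l B eta)
  + (2 * INR z + 1) * (INR q * INR P * INR l).
Proof.
  intros Hq Hl HB He Hr. set (c := 2 * INR z + 1).
  assert (Hz := pos_INR z). assert (Hc : 0 <= c) by (unfold c; lra).
  assert (Hr0 := pos_INR r). assert (Hq0 := pos_INR q). assert (Hl0 := pos_INR l).
  revert x w. induction P as [|P IH]; intros x w Hw1 Hw2.
  - apply subseqw_length in Hw1. rewrite A_str_length, Nat.mul_0_r in Hw1.
    replace (length w) with 0%nat by lia. simpl INR at 1 6 10.
    assert (0 <= rsum (x / l) (error q v l B eta))
      by (apply rsum_nonneg; intros; now apply error_nonneg).
    assert (0 <= c * (INR r * INR q) * INR (x / l / B))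
      by (repeat apply Rmult_le_pos; auto using pos_INR).
    assert (0 <= INR l * INR (x / l)) by (apply Rmult_le_pos; apply pos_INR).
    assert (0 <= c * rsum (x / l) (error q v l B eta)) by (apply Rmult_le_pos; assumption).
    simpl INR. lra.
  - rewrite A_str_period in Hw1 by lia.
    destruct (subseqw_app_inv_r _ _ _ Hw1) as (w1 & w2 & -> & H1 & H2).
    destruct (subseqw_app_slice _ _ _ _ _ (Nat.le_0_l x) Hw2) as (y & Hy & H3 & H4).
    specialize (IH y w1 H1 H3). rewrite length_app, plus_INR, S_INR.
    assert (Hd : (y / l <= x / l)%nat) by (apply Nat.Div0.div_le_mono; lia).
    assert (Hd2 : (y / l / B <= x / l / B)%nat) by (apply Nat.Div0.div_le_mono; lia).
    destruct (Nat.eq_dec (y / l / B) (x / l / B)) as [E|E].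
    + pose proof (period_bound q v l B eta r c (x / l / B) q y x w2
        Hl HB He Hr Hc (Nat.le_refl q) ltac:(lia) E eq_refl H2 H4) as Hp.
      assert (HB0 : 0 < / INR (l * B)) by (apply Rinv_0_lt_compat, lt_0_INR; lia).
      assert (Hm : rsum q (fun i => mu c (dens v i (l * B) (x / l / B)))
                   <= INR z ^ 2 + INR z).
      { apply mu_sum_le.
        - intros. apply Rmult_le_pos; [apply block_bounds|lra].
        - rewrite (rsum_ext q _ (fun i => / INR (l * B) * block v i (l * B) (x / l / B)))
            by (intros; unfold dens, Rdiv; ring).
          rewrite rsum_scal.
          replace 1 with (/ INR (l * B) * INR (l * B))
            by (apply Rinv_l, not_0_INR; lia).
          apply Rmult_le_compat_l; [lra|apply block_sum_le]. }
      apply Rmult_le_compat_l with (r := INR r) in Hm; [|exact Hr0].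
      rewrite E in IH. lra.
    + assert (Hd3 : (S (y / l / B) <= x / l / B)%nat) by lia.
      apply le_INR in Hd3. rewrite S_INR in Hd3.
      apply subseqw_length in H2. rewrite A_str_length in H2. apply le_INR in H2.
      rewrite mult_INR in H2.
      assert (Herr : rsum (y / l) (error q v l B eta) <= rsum (x / l) (error q v l B eta))
        by (apply rsum_le_mono; [intros; now apply error_nonneg|exact Hd]).
      apply le_INR in Hd.
      assert (G1 : c * INR (length w2) <= c * (INR r * INR q))
        by (apply Rmult_le_compat_l; assumption).
      assert (G2 : c * (INR r * INR q) * (INR (y / l / B) + 1) <=
                   c * (INR r * INR q) * INR (x / l / B))
        by (apply Rmult_le_compat_l; [repeat apply Rmult_le_pos; assumption|exact Hd3]).
      assert (G3 : INR l * INR (y / l) <= INR l * INR (x / l))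
        by (apply Rmult_le_compat_l; assumption).
      assert (G4 : c * rsum (y / l) (error q v l B eta) <=
                   c * rsum (x / l) (error q v l B eta))
        by (apply Rmult_le_compat_l; assumption).
      assert (0 <= c * (INR q * INR l)) by (repeat apply Rmult_le_pos; assumption).
      assert (0 <= INR r * (INR z ^ 2 + INR z)) by (apply Rmult_le_pos; [assumption|nra]).
      lra.
Qed.

(** * A cheaply decoded codeword forces an energy drop *)

(** By contradiction: with a smaller drop, [matching_bound] keeps the common subsequence so short
    that insertions plus [2 z] times deletions exceed the threshold. The run length [l * beta] is
    the geometric mean of the two block lengths. *)
Lemma list_decoding_energy_drop q z n l beta H eps gamma delta v D I :
  (1 <= z <= q - 1)%nat -> 0 < eps -> 0 < INR n -> (0 < l)%nat ->
  100 * INR q ^ 2 <= eps * INR beta -> eps < 1 ->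
  (l * beta * beta * beta <= n)%nat ->
  (length v <= l * (H * (beta * beta)))%nat ->
  INR (l * (H * (beta * beta))) <= 3 * INR q * INR n ->
  gamma + 2 * INR z * delta
    <= (1 - eps) * ((2 * INR q - 1) * INR z - INR z ^ 2) / INR q ->
  INR D <= delta * INR n -> INR I <= gamma * INR n ->
  del_ins D I (A_str q (l * beta) n) v ->
  (eps / (20 * INR q)) ^ 2 * INR (l * (H * (beta * beta))) <=
  energy q v l (H * (beta * beta)) - energy q v (l * (beta * beta)) H.
Proof.
  intros Hz He Hn Hl Hbeta He1 Hln Hv HV Hgd HD HI (w & Hw1 & Hw2 & HlD & HlI).
  apply Rnot_lt_le. intros Hlt. rewrite A_str_length in HlD.
  set (B := (beta * beta)%nat) in *. set (r := (l * beta)%nat) in *.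
  assert (Hq : 2 <= INR q) by (replace 2 with (INR 2) by reflexivity; apply le_INR; lia).
  assert (Hz1 : 1 <= INR z) by (replace 1 with (INR 1) by reflexivity; apply le_INR; lia).
  assert (Hzq : INR z + 1 <= INR q) by (rewrite <- S_INR; apply le_INR; lia).
  assert (Hb0 : 0 < INR beta) by nra.
  assert (Hb : (0 < beta)%nat) by now apply INR_lt.
  assert (HB : (0 < B)%nat) by (unfold B; lia).
  assert (Hr : (0 < r)%nat) by (unfold r; lia).
  set (eta := eps / (20 * INR q)) in *.
  assert (Heta : eta * (20 * INR q) = eps) by (unfold eta; field; lra).
  assert (Heta0 : 0 < eta) by nra.
  (* Enough periods to cover [n] letters, with an excess of at most one period. *)
  set (P := S (n / (r * q))).
  assert (HP1 : (n <= r * q * P)%nat).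
  { unfold P. pose proof (Nat.mul_succ_div_gt n (r * q)). nia. }
  assert (HP2 : (r * q * P <= n + r * q)%nat).
  { unfold P. pose proof (Nat.Div0.mul_div_le n (r * q)). lia. }
  apply (subseqw_A_str_le _ _ _ _ _ HP1) in Hw1.
  assert (Hw3 : subseqw w (slice v 0 (length v)))
    by (unfold slice; rewrite Nat.sub_0_r, firstn_all; exact Hw2).
  pose proof (matching_bound q v l B eta r z P (length v) w
    ltac:(lia) Hl HB Heta0 Hr Hw1 Hw3) as M.
  set (V := INR (l * (H * B))) in *.
  (* The fixed costs add up to [V * eta / 2]; the deviations add up to the energy drop, assumed
     below [eta ^ 2 * V], and contribute at most another [V * eta / 2]. *)
  assert (HE : rsum (length v / l) (error q v l B eta) <= V * eta).
  { apply Rle_trans with (rsum (H * B) (error q v l B eta)).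
    - apply rsum_le_mono; [intros; now apply error_nonneg|].
      rewrite <- (Nat.div_mul (H * B) l) by lia. apply Nat.Div0.div_le_mono. lia.
    - unfold error. rewrite rsum_plus, rsum_const.
      rewrite (rsum_ext _ _ (fun u => / (2 * eta) * deviation q v l B u))
        by (intros; unfold Rdiv; ring).
      rewrite rsum_scal, energy_drop by assumption.
      set (dE := energy q v l (H * B) - energy q v (l * B) H) in *.
      replace (INR (H * B) * (INR l * eta / 2)) with (V * eta / 2)
        by (unfold V; rewrite (mult_INR l); field).
      assert (/ (2 * eta) * dE <= / (2 * eta) * (eta ^ 2 * V)).
      { apply Rmult_le_compat_l; [|lra]. left. apply Rinv_0_lt_compat. lra. }
      replace (/ (2 * eta) * (eta ^ 2 * V)) with (V * eta / 2) in H0 by (field; lra).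
      lra. }
  assert (HX1 : INR r * INR beta * INR (length v / l / B) <= V).
  { unfold V. rewrite <- !mult_INR. apply le_INR.
    pose proof (Nat.Div0.mul_div_le (length v) l).
    pose proof (Nat.Div0.mul_div_le (length v / l) B). unfold r, B in *. nia. }
  assert (HX2 : INR l * INR (length v / l) <= INR (length v)).
  { rewrite <- mult_INR. apply le_INR. apply Nat.Div0.mul_div_le. }
  assert (Hrn : INR r * INR beta <= INR n).
  { rewrite <- mult_INR. apply le_INR. unfold r. nia. }
  apply le_INR in HP2. rewrite plus_INR, !mult_INR in HP2.
  assert (Hrl : INR r = INR l * INR beta) by (unfold r; apply mult_INR).
  assert (EI := f_equal INR HlI). rewrite plus_INR in EI.
  assert (ED := f_equal INR HlD). rewrite plus_INR in ED.
  assert (Hl0 : 0 < INR l) by now apply lt_0_INR.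
  assert (Hr0 : 0 < INR r) by now apply lt_0_INR.
  assert (HP0 : 0 <= INR P) by apply pos_INR.
  set (X1 := INR (length v / l / B)) in *.
  assert (HX0 : 0 <= X1) by apply pos_INR.
  set (E := rsum (length v / l) (error q v l B eta)) in *.
  set (Q := INR q) in *. set (Z := INR z) in *. set (N := INR n) in *.
  set (bt := INR beta) in *. set (R0 := INR r) in *. set (L := INR l) in *.
  clearbody X1 E V eta Q Z N bt R0 L.
  generalize dependent (INR P). intros p HP2 M HP0.
  (* Since [1 <= g * bt], a factor [bt] between two lengths makes their ratio at most [g]; this
     gives [T1], [T2] and [T3]. *)
  set (g := eps / (100 * Q ^ 2)).
  assert (Hg : g * (100 * Q ^ 2) = eps) by (unfold g; field; lra).
  assert (Hg0 : 0 < g) by (unfold g; apply Rdiv_lt_0_compat; nra).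
  assert (HgQ : g * Q * 100 <= eps).
  { rewrite <- Hg. assert (0 <= g * Q) by nra. nra. }
  assert (Hg1 : g * 100 <= eps) by nra.
  assert (Hgb : 1 <= g * bt).
  { apply Rmult_le_reg_r with (100 * Q ^ 2); [nra|]. nra. }
  assert (T1 : R0 * X1 <= g * V).
  { assert (R0 * X1 <= R0 * X1 * (g * bt)) by (assert (0 <= R0 * X1) by nra; nra). nra. }
  assert (T2 : R0 <= g * N) by nra.
  assert (T3 : L <= g * R0) by nra.
  assert (T4 : R0 * Q <= N).
  { assert (g * Q <= 1) by nra. nra. }
  (* The losses come from periods crossing large blocks ([E1]), the incomplete last period ([E2]),
     density errors ([E3]) and rounding to small blocks ([E4]). Together they are at most 61 percent
     of [eps * Z * N]. *)
  assert (E1 : (2 * Z + 1) * (R0 * Q) * X1 <= 9 / 100 * (eps * Z * N)).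
  { replace ((2 * Z + 1) * (R0 * Q) * X1) with ((2 * Z + 1) * Q * (R0 * X1)) by ring.
    apply Rle_trans with (3 * Z * Q * (g * (3 * Q * N))).
    - apply Rmult_le_compat; try nra.
    - rewrite <- Hg. nra. }
  assert (E2 : R0 * p * (Z ^ 2 + Z) <= N * (Z ^ 2 + Z) / Q + 1 / 100 * (eps * Z * N)).
  { assert (R0 * p <= N / Q + R0).
    { apply Rmult_le_reg_r with Q; [lra|].
      replace ((N / Q + R0) * Q) with (N + R0 * Q) by (field; lra). lra. }
    assert (R0 * p * (Z ^ 2 + Z) <= (N / Q + R0) * (Z ^ 2 + Z))
      by (apply Rmult_le_compat_r; nra).
    assert (R0 * (Z ^ 2 + Z) <= 1 / 100 * (eps * Z * N)).
    { apply Rle_trans with (g * N * (Z * Q)).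
      - apply Rmult_le_compat; nra.
      - assert (0 <= Z * N) by nra. nra. }
    unfold Rdiv in *. lra. }
  assert (E3 : (2 * Z + 1) * E <= 45 / 100 * (eps * Z * N)).
  { apply Rle_trans with (3 * Z * (3 * Q * N * eta)).
    - apply Rle_trans with (3 * Z * (V * eta)).
      + apply Rle_trans with ((2 * Z + 1) * (V * eta)).
        * apply Rmult_le_compat_l; lra.
        * apply Rmult_le_compat_r; [|lra]. assert (0 <= R0 * X1) by nra.
          assert (0 <= V) by nra. nra.
      + apply Rmult_le_compat_l; [lra|]. apply Rmult_le_compat_r; lra.
    - rewrite <- Heta. nra. }
  assert (E4 : (2 * Z + 1) * (Q * p * L) <= 6 / 100 * (eps * Z * N)).
  { assert (Q * p * L <= Q * p * (g * R0)) by (apply Rmult_le_compat_l; nra).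
    assert (g * (R0 * Q * p) <= g * (2 * N)) by (apply Rmult_le_compat_l; lra).
    apply Rle_trans with (3 * Z * (g * (2 * N))).
    - apply Rmult_le_compat; try lra. repeat apply Rmult_le_pos; lra.
    - assert (0 <= Z * N) by nra. nra. }
  (* The cost is [|v| + 2 Z N - (2 Z + 1) |w|], hence at least [tau * N] minus the losses. As
     [Z <= tau], the losses stay below [eps * tau * N], which contradicts [Hcost]. *)
  set (tau := ((2 * Q - 1) * Z - Z ^ 2) / Q).
  assert (Htau : tau = 2 * Z - (Z ^ 2 + Z) / Q) by (unfold tau; field; lra).
  assert (HtauZ : Z <= tau).
  { apply Rmult_le_reg_r with Q; [lra|]. unfold tau.
    replace (((2 * Q - 1) * Z - Z ^ 2) / Q * Q) with ((2 * Q - 1) * Z - Z ^ 2)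
      by (field; lra). nra. }
  assert (Hcost : INR I + 2 * Z * INR D <= (1 - eps) * tau * N).
  { apply Rle_trans with ((gamma + 2 * Z * delta) * N); [nra|].
    apply Rmult_le_compat_r; [lra|]. unfold tau. unfold Rdiv in *. lra. }
  assert (0 < eps * N) by nra.
  assert (eps * N * Z <= eps * N * tau) by (apply Rmult_le_compat_l; lra).
  assert (Hx : N * (Z ^ 2 + Z) / Q = N * (2 * Z - tau)) by (rewrite Htau; field; lra).
  nra.
Qed.

(** * Counting the run lengths on a list *)

(** Used to replace a list of codewords by the list of their exponents. *)
Lemma In_inv_image (A : Type) (f : nat -> A) (Q : A -> Prop) (P : nat -> Prop) (L : list A) :
  (forall c, In c L -> (exists k, P k /\ c = f k) /\ Q c) ->
  exists ks, map f ks = L /\ forall k, In k ks -> P k /\ Q (f k).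
Proof.
  induction L as [|c L IH]; intros H.
  - exists []. split; [reflexivity|]. intros k [].
  - destruct IH as (ks & <- & Hks); [intros; apply H; now right|].
    destruct (H c (or_introl eq_refl)) as ((k & Hk & ->) & HQ).
    exists (k :: ks). split; [reflexivity|]. intros k' [<-|Hk']; auto.
Qed.

(* Every unit step of the scale is counted at most [2 m] times. *)
Lemma rsum_shifted_drop T m (F : nat -> R) C :
  (forall k, (k < T + 2 * m)%nat -> 0 <= F k <= C) ->
  rsum T (fun k => F k - F (k + 2 * m)%nat) <= 2 * INR m * C.
Proof.
  intros H.
  assert (E : rsum T (fun k => F k - F (k + 2 * m)%nat) =
              rsum (2 * m) F - rsum (2 * m) (fun j => F (T + j)%nat)).
  { pose proof (rsum_add T (2 * m) F) as A1. pose proof (rsum_add (2 * m) T F) as A2.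
    rewrite Nat.add_comm, A1 in A2.
    rewrite (rsum_ext T _ (fun k => F k + -1 * F (2 * m + k)%nat))
      by (intros; rewrite (Nat.add_comm _ (2 * m)); ring).
    rewrite rsum_plus, rsum_scal. lra. }
  assert (0 <= rsum (2 * m) (fun j => F (T + j)%nat))
    by (apply rsum_nonneg; intros; apply H; lia).
  assert (G : rsum (2 * m) F <= rsum (2 * m) (fun _ => C))
    by (apply rsum_le; intros; apply H; lia).
  rewrite rsum_const, mult_INR in G. simpl INR in G. lra.
Qed.

(** From [eps ^ 4 * b >= 1] and [eps < 1] follows [eps * b >= 1]. This uses one factor [b]; the
    others give at least [2 ^ (2 * q + 7)], which is at least [128 * q ^ 2]. *)
Lemma pow_separation q b eps :
  0 < eps < 1 -> 1 / eps ^ 4 <= INR b ->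
  (2 <= b)%nat /\ 100 * INR q ^ 2 <= eps * INR (b ^ (2 * q + 8)).
Proof.
  intros He Hb.
  assert (Hb1 : 1 <= eps ^ 4 * INR b).
  { replace 1 with (eps ^ 4 * (1 / eps ^ 4)) by (field; lra).
    apply Rmult_le_compat_l; [|exact Hb]. apply pow_le. lra. }
  assert (Hb0 := pos_INR b).
  assert (He3 : eps ^ 3 < 1) by (simpl; nra).
  assert (He4 : eps ^ 4 * INR b <= eps * INR b).
  { apply Rmult_le_compat_r; [exact Hb0|].
    replace (eps ^ 4) with (eps * eps ^ 3) by ring. nra. }
  assert (Hb2 : (2 <= b)%nat) by (apply INR_lt; simpl INR; nra).
  split; [exact Hb2|].
  assert (Hq : (128 * (q * q) <= b ^ (2 * q + 7))%nat).
  { transitivity (2 ^ (2 * q + 7))%nat; [|now apply Nat.pow_le_mono_l].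
    assert (q < 2 ^ q)%nat by (apply Nat.pow_gt_lin_r; lia).
    replace (2 * q + 7)%nat with (7 + (q + q))%nat by lia.
    rewrite !Nat.pow_add_r. change (2 ^ 7)%nat with 128%nat. nia. }
  apply le_INR in Hq. rewrite !mult_INR in Hq.
  replace (INR 128) with 128 in Hq by (simpl; ring).
  replace (2 * q + 8)%nat with (S (2 * q + 7)) by lia.
  rewrite Nat.pow_succ_r', mult_INR.
  assert (1 * INR (b ^ (2 * q + 7)) <= eps * INR b * INR (b ^ (2 * q + 7)))
    by (apply Rmult_le_compat_r; [apply pos_INR|lra]).
  nra.
Qed.

(** Bounds [gamma], and thereby the length of [v] by a multiple of [q * n]. *)
Lemma threshold_le eps q z :
  0 < eps < 1 -> (1 <= z <= q - 1)%nat ->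
  (1 - eps) * ((2 * INR q - 1) * INR z - INR z ^ 2) / INR q <= 2 * INR q - 2.
Proof.
  intros He Hz.
  assert (Hz1 : 1 <= INR z) by (apply (le_INR 1); lia).
  assert (Hzq : INR z + 1 <= INR q) by (rewrite <- S_INR; apply le_INR; lia).
  apply Rmult_le_reg_r with (INR q); [lra|].
  unfold Rdiv. rewrite Rmult_assoc, Rinv_l by lra.
  assert (0 <= (2 * INR q - 1) * INR z - INR z ^ 2 <= 2 * INR q * INR z) by nra.
  nra.
Qed.

(** Each exponent in [S] forces a drop of at least [eta ^ 2 * V] between the scales [k - m] and
    [k + m], while all these drops add up to at most [2 * m * V]. The margins around [S] keep both
    scales in range. *)
Lemma list_decoding_middle_count q z n b eps gamma delta v kt (S : list nat) :
  let m := (2 * q + 8)%nat in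
  (1 <= z <= q - 1)%nat -> 0 < eps < 1 -> 1 / eps ^ 4 <= INR b ->
  0 <= delta ->
  gamma + 2 * INR z * delta
    <= (1 - eps) * ((2 * INR q - 1) * INR z - INR z ^ 2) / INR q ->
  (b ^ kt < n)%nat -> NoDup S ->
  (forall k, In k S -> (m <= k /\ k + 2 * m <= kt)%nat /\
     exists D I : nat, INR D <= delta * INR n /\ INR I <= gamma * INR n /\
                       del_ins D I (A_str q (b ^ k) n) v) ->
  INR (length S) * eps ^ 2 <= 4800 * INR q ^ 3.
Proof.
  intros m Hz He Hb Hd Hgd Hkt HS H.
  assert (Hq : 2 <= INR q) by (apply (le_INR 2); lia).
  assert (Hz1 : 1 <= INR z) by (apply (le_INR 1); lia).
  (* The empty list is trivial; otherwise one decoded codeword bounds the length of [v], and its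
     exponent shows [3 * m <= kt]. *)
  destruct S as [|k0 S0] eqn:ES.
  { simpl. assert (0 <= INR q ^ 3) by (apply pow_le; lra). lra. }
  rewrite <- ES in *.
  destruct (H k0) as ([Hk0 Hk0'] & D0 & I0 & _ & HI0 & w0 & Hw0 & _ & HlD & HlI);
    [rewrite ES; now left|].
  rewrite A_str_length in HlD.
  destruct (pow_separation q b eps He Hb) as [Hb2 Hbeta]. fold m in Hbeta.
  assert (Hpow : forall j, (0 < b ^ j)%nat)
    by (intros; apply Nat.neq_0_lt_0, Nat.pow_nonzero; lia).
  assert (Hn : 0 < INR n) by (apply lt_0_INR; pose proof (Hpow kt); lia).
  pose proof (threshold_le eps q z He Hz) as Hthr.
  (* The coarsest scale is [b ^ t]. The length [V] is a multiple of it that covers [v], hence is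
     divisible by every finer scale; rounding up adds at most [b ^ t <= n]. *)
  set (t := (kt - m)%nat). set (H0 := Datatypes.S (length v / b ^ t)).
  set (V := (b ^ t * H0)%nat).
  assert (HvV : (length v <= V)%nat).
  { unfold V, H0. pose proof (Nat.mul_succ_div_gt (length v) (b ^ t)).
    pose proof (Hpow t). lia. }
  assert (HV : INR V <= 3 * INR q * INR n).
  { assert (G : (V <= length v + n)%nat).
    { unfold V, H0. pose proof (Nat.Div0.mul_div_le (length v) (b ^ t)).
      assert (b ^ t <= b ^ kt)%nat by (apply Nat.pow_le_mono_r; unfold t; lia). lia. }
    assert (length v <= n + I0)%nat by lia.
    assert (G2 : (V <= 2 * n + I0)%nat) by lia.
    apply le_INR in G2. rewrite plus_INR, mult_INR in G2. simpl (INR 2) in G2.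
    assert (0 <= 2 * INR z * delta) by (apply Rmult_le_pos; lra).
    assert (gamma * INR n <= (2 * INR q - 2) * INR n)
      by (apply Rmult_le_compat_r; lra).
    nra. }
  assert (HV0 : 0 < INR V) by (apply lt_0_INR; unfold V, H0; pose proof (Hpow t); lia).
  set (F := fun j => energy q v (b ^ j) (H0 * b ^ (t - j))).
  (* The finer scale is indexed by [j = k - m], which runs from 0 to [kt - 3 * m]. *)
  set (T := (kt - 3 * m + 1)%nat).
  set (eta := eps / (20 * INR q)).
  assert (HVj : forall j, (j <= t)%nat -> (b ^ j * (H0 * b ^ (t - j)) = V)%nat).
  { intros j Hj. unfold V. replace t with (j + (t - j))%nat at 2 by lia.
    rewrite Nat.pow_add_r. ring. }
  assert (U : rsum T (fun j => F j - F (j + 2 * m)%nat) <= 2 * INR m * INR V).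
  { apply rsum_shifted_drop. intros j Hj. split; [now apply energy_nonneg|].
    rewrite <- (HVj j) by (unfold T, t in *; lia). now apply energy_le. }
  assert (E : forall j, (j < T)%nat ->
    (H0 * b ^ (t - j) = H0 * b ^ (t - (j + 2 * m)) * (b ^ m * b ^ m))%nat /\
    (b ^ (j + 2 * m) = b ^ j * (b ^ m * b ^ m))%nat).
  { intros j Hj.
    assert (G : (b ^ m * b ^ m)%nat = (b ^ (2 * m))%nat)
      by (rewrite <- Nat.pow_add_r; f_equal; lia).
    rewrite G. split; [|apply Nat.pow_add_r].
    replace (t - j)%nat with (t - (j + 2 * m) + 2 * m)%nat by (unfold T, t in *; lia).
    rewrite Nat.pow_add_r. ring. }
  assert (Lw : INR (length (map (fun k => k - m)%nat S)) * (eta ^ 2 * INR V) <=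
               rsum T (fun j => F j - F (j + 2 * m)%nat)).
  { apply rsum_NoDup_ge.
    - intros j Hj. unfold F. destruct (E j Hj) as [-> ->].
      rewrite <- energy_drop by (try apply Nat.mul_pos_pos; apply Hpow).
      apply rsum_nonneg. intros. now apply deviation_nonneg.
    - apply NoDup_map_NoDup_ForallPairs; [|exact HS].
      intros k k' Hk Hk' Heq. apply H in Hk, Hk'. lia.
    - intros j Hj. apply in_map_iff in Hj. destruct Hj as (k & <- & Hk).
      destruct (H k Hk) as ([Hmk Hkm] & D & I & HD & HI & Hdi).
      assert (HjT : (k - m < T)%nat) by (unfold T; lia). split; [exact HjT|].
      assert (HV' := HVj (k - m)%nat ltac:(unfold t; lia)).
      unfold F. destruct (E _ HjT) as [E2 E3]. rewrite E2 in HV' |- *. rewrite E3.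
      rewrite <- HV'. unfold eta.
      apply (list_decoding_energy_drop q z n _ _ _ eps gamma delta v D I); try assumption.
      + lra.
      + apply Hpow.
      + lra.
      + rewrite <- !Nat.pow_add_r. etransitivity; [|apply Nat.lt_le_incl, Hkt].
        apply Nat.pow_le_mono_r; lia.
      + rewrite HV'. exact HvV.
      + rewrite HV'. exact HV.
      + rewrite <- Nat.pow_add_r. replace (k - m + m)%nat with k by lia. exact Hdi. }
  rewrite length_map in Lw.
  assert (Heta : eta * (20 * INR q) = eps) by (unfold eta; field; lra).
  assert (G : INR (length S) * eta ^ 2 <= 2 * INR m)
    by (apply Rmult_le_reg_r with (INR V); lra).
  assert (Hm : INR m <= 6 * INR q).
  { replace 6 with (INR 6) by (simpl; ring). rewrite <- mult_INR. apply le_INR.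
    unfold m. lia. }
  (* The constant is [400 * 12]: [eps ^ 2] is [400 * q ^ 2 * eta ^ 2], and [2 * m] is at most
     [12 * q]. *)
  rewrite <- Heta.
  replace (INR (length S) * (eta * (20 * INR q)) ^ 2)
    with (400 * INR q ^ 2 * (INR (length S) * eta ^ 2)) by ring.
  replace (4800 * INR q ^ 3) with (400 * INR q ^ 2 * (12 * INR q)) by ring.
  apply Rmult_le_compat_l; [|lra]. pose proof (pow2_ge_0 (INR q)). lra.
Qed.

Lemma list_max_In (l : list nat) : l <> [] -> In (list_max l) l.
Proof.
  induction l as [|a l IH]; [easy|]. intros _. simpl.
  destruct (Nat.max_spec a (list_max l)) as [[H ->]|[_ ->]]; [right|now left].
  apply IH. intros ->. simpl in H. lia.
Qed.

Theorem theorem5p3 :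
  exists K : R, 0 < K /\
  forall (q : nat), (2 <= q)%nat ->
  forall (eps : R), 0 < eps ->
  forall (b : nat), INR b - 1 < 1 / eps ^ 4 <= INR b ->
  exists N : nat, forall n : nat, (N <= n)%nat ->
  forall (z : nat), (1 <= z <= q - 1)%nat ->
  forall (gamma delta : R), 0 <= gamma -> 0 <= delta ->
    gamma + 2 * INR z * delta
      <= (1 - eps) * ((2 * INR q - 1) * INR z - INR z ^ 2) / INR q ->
  forall (v : word) (L : list word),
    NoDup L ->
    (forall c, In c L ->
       in_code q b n c /\
       exists D I : nat, INR D <= delta * INR n /\ INR I <= gamma * INR n /\
                         del_ins D I c v) ->
    INR (length L) <= K * INR q ^ 5 / eps ^ 2.
Proof.
  (* The estimate holds for every [n], so the threshold is 0. The constant 5000 absorbs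
     [4800 * q ^ 3] from the middle exponents and [18 * q] from the extreme ones. *)
  exists 5000. split; [lra|]. intros q Hq2 eps He b Hb. exists 0%nat.
  intros n _ z Hz gamma delta Hg Hd Hgd v L HL HC.
  assert (Hq : 2 <= INR q) by (apply (le_INR 2); lia).
  assert (Hz1 : 1 <= INR z) by (apply (le_INR 1); lia).
  assert (Hzq : INR z + 1 <= INR q) by (rewrite <- S_INR; apply le_INR; lia).
  assert (Hq2' : 4 <= INR q ^ 2) by nra.
  assert (Hq3 : 4 * INR q <= INR q ^ 3) by (simpl in *; nra).
  assert (Hq5 : 4 * INR q ^ 3 <= INR q ^ 5)
    by (replace (INR q ^ 5) with (INR q ^ 2 * INR q ^ 3) by ring; nra).
  assert (He2 : 0 < eps ^ 2) by nra.
  apply Rmult_le_reg_r with (eps ^ 2); [exact He2|].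
  replace (5000 * INR q ^ 5 / eps ^ 2 * eps ^ 2) with (5000 * INR q ^ 5) by (field; lra).
  destruct (Rlt_le_dec eps 1) as [He1|He1].
  - destruct (In_inv_image _ (fun k => A_str q (b ^ k) n)
      (fun c => exists D I : nat, INR D <= delta * INR n /\ INR I <= gamma * INR n /\
                del_ins D I c v) (fun k => (b ^ k < n)%nat) L HC) as (ks & <- & Hks).
    apply NoDup_map_inv in HL. rewrite length_map.
    (* The margin is measured from the largest exponent on the list, which is known to satisfy
       [b ^ kt < n]. Only the [m] lowest and the [2 * m] highest possible exponents are set
       aside. *)
    set (m := (2 * q + 8)%nat). set (kt := list_max ks).
    set (S := filter (fun k => (m <=? k) && (k + 2 * m <=? kt))%bool ks).
    assert (Hmax : forall k, In k ks -> (k <= kt)%nat).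
    { apply Forall_forall, list_max_le. apply Nat.le_refl. }
    assert (HS : forall k, In k S <-> In k ks /\ (m <= k /\ k + 2 * m <= kt)%nat).
    { intros k. unfold S.
      rewrite filter_In, Bool.andb_true_iff, !Nat.leb_le. reflexivity. }
    assert (Hlen : (length ks <= length S + 3 * m)%nat).
    { etransitivity.
      - apply (NoDup_incl_length (l' := S ++ seq 0 m ++ seq (kt + 1 - 2 * m) (2 * m)) HL).
        intros k Hk. rewrite !in_app_iff, HS, !in_seq. specialize (Hmax k Hk).
        destruct (le_lt_dec m k); destruct (le_lt_dec (k + 2 * m) kt); [left|right..];
          [tauto|right|left|left]; lia.
      - rewrite !length_app, !length_seq. lia. }
    assert (HSn : INR (length S) * eps ^ 2 <= 4800 * INR q ^ 3).
    { assert (ks = [] \/ ks <> []) as [Eks|Hne] by (destruct ks; [now left|now right]).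
      { unfold S. rewrite Eks. simpl in *. lra. }
      apply (list_decoding_middle_count q z n b eps gamma delta v kt); try easy.
      - apply Hks. now apply list_max_In.
      - apply NoDup_filter, HL.
      - intros k Hk. apply HS in Hk. destruct Hk as [Hk Hk']. split; [exact Hk'|].
        apply Hks, Hk. }
    apply le_INR in Hlen. rewrite plus_INR, mult_INR in Hlen.
    replace (INR 3) with 3 in Hlen by (simpl; ring).
    assert (Hm : INR m <= 6 * INR q).
    { replace 6 with (INR 6) by (simpl; ring). rewrite <- mult_INR. apply le_INR.
      unfold m. lia. }
    assert (eps ^ 2 <= 1) by nra.
    assert (INR (length ks) * eps ^ 2 <= (INR (length S) + 18 * INR q) * eps ^ 2)
      by (apply Rmult_le_compat_r; lra).
    assert (18 * INR q * eps ^ 2 <= 18 * INR q * 1) by (apply Rmult_le_compat_l; lra).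
    lra.
  (* For [eps >= 1] the nonnegative cost forces [eps = 1], hence [b = 1], and all powers of [b] give
     the same codeword. *)
  - assert (Hthr : 0 <= (1 - eps) * (((2 * INR q - 1) * INR z - INR z ^ 2) / INR q)).
    { unfold Rdiv in *. rewrite <- Rmult_assoc.
      assert (0 <= 2 * INR z * delta) by (apply Rmult_le_pos; lra). lra. }
    assert (0 < ((2 * INR q - 1) * INR z - INR z ^ 2) / INR q)
      by (apply Rdiv_lt_0_compat; nra).
    assert (eps = 1) as -> by nra.
    assert (b = 1)%nat as ->.
    { destruct Hb as [Hb1 Hb2]. replace (1 / 1 ^ 4) with 1 in Hb1, Hb2 by field.
      assert (b < 2)%nat by (apply INR_lt; simpl; lra).
      assert (0 < b)%nat by (apply INR_lt; simpl; lra). lia. }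
    assert (Hlen : (length L <= length [A_str q 1 n])%nat).
    { apply NoDup_incl_length; [exact HL|]. intros c Hc.
      destruct (HC c Hc) as [(k & _ & ->) _]. rewrite Nat.pow_1_l. now left. }
    apply le_INR in Hlen. simpl (INR (length [_])) in Hlen. lra.
Qed.
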